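(* Suppose $[0,1]_*=([0,1],\min,\max,*,\rightarrowtail,0,1)$ is a BL-algebra, and let $T_*$ be the topology on $[0,1]$ consisting of all $*$-open subsets of $[0,1]$. Then $T_*$ is a Hausdorff topology on $[0,1]$.
   Context: A BL-algebra is an algebra $\mathcal{L}=(L,\wedge,\vee,*,\rightarrowtail,0,1)$ of type $(2,2,2,2,0,0)$ such that: (BL1) $(L,\wedge,\vee,0,1)$ is a bounded lattice with greatest element $1$ and smallest element $0$; (BL2) $(L,*,1)$ is an Abelian monoid; (BL3) $c\le a\rightarrowtail b$ iff $c*a\le b$ for all $a,b,c\in L$; (BL4) $a\wedge b=a*(a\rightarrowtail b)$ for all $a,b\in L$; (BL5) $(a\rightarrowtail b)\vee(b\rightarrowtail a)=1$ for all $a,b\in L$. Here $L=[0,1]$ is the real unit interval with its usual order. An element $a\in L$ is strongly less than $1$, written $a\ll 1$, if for every $b\in L$, $a\vee b=1$ implies $b=1$ (on $[0,1]$ this just means $a<1$). Define $a\leftrightarrow b=(a\rightarrowtail b)*(b\rightarrowtail a)$ for $a,b\in L$. For $a,r\in L$ with $r\ll 1$, the $*$-ball around $a$ of radius $r$ is $B_r(a)=\{b\in L: a\leftrightarrow b>r\}$. A subset $G\subseteq L$ is $*$-open if for every $a\in G$ there exists $r\in L$ with $r\ll 1$ and $B_r(a)\subseteq G$. The $*$-open subsets of $L$ form a topology $T_*$. *)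

(* Defs.v *)
From HB Require Import structures.
From mathcomp Require Import all_boot all_order all_algebra.
From mathcomp Require Import interval_inference.
From mathcomp Require Import boolp classical_sets reals topology.

Set Implicit Arguments.
Unset Strict Implicit.
Unset Printing Implicit Defensive.

Import Order.TTheory GRing.Theory Num.Theory.

Section BLAlgebra.
Context {d : Order.disp_t} {L : tbLatticeType d}.
Local Open Scope order_scope.

Record is_BL_algebra (mul imp : L -> L -> L) : Prop := IsBLAlgebra {
  BL_mulA : associative mul;
  BL_mulC : commutative mul;
  BL_mul1 : left_id \top mul;
  BL_residuation : forall a b c : L, c <= imp a b <-> mul c a <= b;
  BL_divisibility : forall a b : L, a `&` b = mul a (imp a b);
  BL_prelinearity : forall a b : L, imp a b `|` imp b a = \top
}.

Definition strongly_lt1 (a : L) : Prop :=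
  forall b : L, a `|` b = \top -> b = \top.

Variables mul imp : L -> L -> L.

Definition biimp (a b : L) : L := mul (imp a b) (imp b a).

Definition star_ball (a r : L) : set L := [set b | r < biimp a b]%classic.

Definition star_open (G : set L) : Prop :=
  forall a, G a -> exists2 r, strongly_lt1 r & (star_ball a r `<=` G)%classic.

Lemma strongly_lt1_bot : strongly_lt1 \bot.
Proof. by move=> b; rewrite join0x. Qed.

Lemma strongly_lt1_join r s :
  strongly_lt1 r -> strongly_lt1 s -> strongly_lt1 (r `|` s).
Proof. by move=> hr hs b; rewrite -joinA => /hr/hs. Qed.

Lemma star_openT : star_open setT.
Proof. by move=> a _; exists \bot => //; exact: strongly_lt1_bot. Qed.

Lemma star_openI : setI_closed star_open.
Proof.
move=> G H oG oH a [Ga Ha].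
have [r hr rG] := oG a Ga; have [s hs sH] := oH a Ha.
exists (r `|` s); first exact: strongly_lt1_join.
move=> b rsb; split; [apply: rG|apply: sH]; apply: le_lt_trans rsb.
  exact: leUl.
exact: leUr.
Qed.

Lemma star_open_bigU (I : Type) (f : I -> set L) :
  (forall i, star_open (f i)) -> star_open (\bigcup_i f i)%classic.
Proof.
move=> of_ a [i _ fia]; have [r hr rf] := of_ i a fia.
by exists r => // b /rf fib; exists i.
Qed.

(* A copy of [L] carrying the topology T_*; only the lattice structure of [L]
   is needed for the *-open sets to form a topology. The vacuous [let] makes
   the type depend on the operations, so that the topology can be inferred. *)
Definition star_space : Type := let _ := (mul, imp) in L.

HB.instance Definition _ := Choice.copy star_space L.
HB.instance Definition _ := @isOpenTopological.Build star_space
  star_open star_openT star_openI star_open_bigU.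

Lemma open_star_space (G : set star_space) : open G = star_open G.
Proof. by []. Qed.

End BLAlgebra.

Arguments star_space {d L} mul imp.

(* The type [{i01 R}] is only totally ordered in the library: [unit_itv R] adds
   the bounds, so that it is a [tbLatticeType] for the order of [R]. *)
Definition unit_itv (R : realType) : Type := {i01 R}.

Section UnitInterval.
Context {R : realType}.
Local Open Scope ring_scope.

HB.instance Definition _ := Order.Total.copy (unit_itv R) {i01 R}.

Lemma unit_itv_ge0 (x : unit_itv R) : (0%:i01 : unit_itv R) <= x.
Proof. by rewrite -num_le /=. Qed.

Lemma unit_itv_le1 (x : unit_itv R) : x <= (1%:i01 : unit_itv R).
Proof. by rewrite -num_le /=. Qed.

HB.instance Definition _ :=
  Order.hasBottom.Build ring_display (unit_itv R) unit_itv_ge0.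
HB.instance Definition _ :=
  Order.hasTop.Build ring_display (unit_itv R) unit_itv_le1.

Lemma unit_itv_botE : (\bot%O : unit_itv R)%:num = 0 :> R.
Proof. by []. Qed.

Lemma unit_itv_topE : (\top%O : unit_itv R)%:num = 1 :> R.
Proof. by []. Qed.

Lemma unit_itv_leE (x y : unit_itv R) : (x <= y) = (x%:num <= y%:num).
Proof. by []. Qed.

Lemma unit_itv_meetE (x y : unit_itv R) : (x `&` y)%O = Order.min x y.
Proof. exact: meetEtotal. Qed.

Lemma unit_itv_joinE (x y : unit_itv R) : (x `|` y)%O = Order.max x y.
Proof. exact: joinEtotal. Qed.

End UnitInterval.

(* Main.v *)
Require Import Defs.
From mathcomp Require Import all_boot all_order all_algebra.
From mathcomp Require Import interval_inference.
From mathcomp Require Import boolp classical_sets reals topology.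

(** Residuation makes [*] left-continuous at 1: if [r < t] then [t -> r < 1],
    and any [x] strictly between [t -> r] and 1 satisfies [r < x * t]. Since
    [<->] behaves like a metric, with [(a <-> b) * (b <-> c) <= a <-> c] as
    triangle inequality, it follows that balls are *-open; and, if [a != b], so
    that [a <-> b < 1], that some [s < 1] has [a <-> b < s * s], which makes the
    balls of radius [s] around [a] and [b] disjoint. *)

Set Implicit Arguments.
Unset Strict Implicit.
Unset Printing Implicit Defensive.

Import Order.TTheory GRing.Theory Num.Theory.

Section ResiduatedLattice.
Context {d : Order.disp_t} {L : tbLatticeType d}.
Variables mul imp : L -> L -> L.
Hypothesis BL : is_BL_algebra mul imp.
Local Open Scope order_scope.

Let mulA := BL_mulA BL.
Let mulC := BL_mulC BL.
Let mul1 := BL_mul1 BL.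
Let residuation := BL_residuation BL.

(** By residuation [v <= imp w (mul v w)], so [u <= v] gives monotonicity in the first factor;
    commutativity handles the second. *)
Lemma BL_le_mul x x' y y' : x <= x' -> y <= y' -> mul x y <= mul x' y'.
Proof.
have le_mull u v w : u <= v -> mul u w <= mul v w.
  by move=> uv; apply/residuation/(le_trans uv)/residuation.
move=> xx' yy'; apply: (le_trans (le_mull _ _ _ xx')).
by rewrite !(mulC x'); exact: le_mull.
Qed.

Lemma BL_mul_lel x y : mul x y <= x.
Proof. by rewrite -[leRHS]mul1 mulC BL_le_mul ?lex1. Qed.

Lemma BL_mul_ler x y : mul x y <= y.
Proof. by rewrite mulC BL_mul_lel. Qed.

Lemma BL_imp_top a b : (imp a b == \top) = (a <= b).
Proof.
rewrite -le1x; apply/idP/idP => [/residuation|ab]; first by rewrite mul1.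
by apply/residuation; rewrite mul1.
Qed.

(** Modus ponens, [mul (imp x y) x <= y], is used twice: from [a] to [b], then from [b] to [c]. *)
Lemma BL_imp_trans a b c : mul (imp a b) (imp b c) <= imp a c.
Proof.
apply/residuation; rewrite (mulC (imp a b)) -mulA.
apply: (@le_trans _ _ (mul (imp b c) b)); last exact/residuation.
by apply: BL_le_mul => //; exact/residuation.
Qed.

Lemma biimpxx a : biimp mul imp a a = \top.
Proof.
have /eqP aa1 : imp a a == \top by rewrite BL_imp_top.
by rewrite /biimp aa1 mul1.
Qed.

Lemma biimpC a b : biimp mul imp a b = biimp mul imp b a.
Proof. exact: mulC. Qed.

Lemma biimp_top a b : biimp mul imp a b = \top -> a = b.
Proof.
(* A product lies below both factors, so both implications are [\top]. *)
move=> ab1; apply: le_anti; rewrite -!BL_imp_top -!le1x -ab1.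
by rewrite BL_mul_lel BL_mul_ler.
Qed.

Lemma biimp_trans a b c :
  mul (biimp mul imp a b) (biimp mul imp b c) <= biimp mul imp a c.
Proof.
(* Regroup so that implications chain: [a] to [b] to [c], and [c] to [b] to [a]. *)
have -> : mul (biimp mul imp a b) (biimp mul imp b c) =
    mul (mul (imp a b) (imp b c)) (mul (imp c b) (imp b a)).
  rewrite /biimp -!mulA; congr mul.
  by rewrite mulC -!mulA.
by apply: BL_le_mul; exact: BL_imp_trans.
Qed.

End ResiduatedLattice.

(** In a chain, a join is one of its two arguments. *)
Lemma lt1_strongly_lt1 {d : Order.disp_t} {L : tbOrderType d} (r : L) :
  (r < \top)%O -> strongly_lt1 r.
Proof.
move=> r1 b; rewrite joinEtotal; case: leP => // _ r1E.
by rewrite r1E ltxx in r1.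
Qed.

Section DenseChain.
Context {d : Order.disp_t} {L : tbOrderType d}.
Variables mul imp : L -> L -> L.
Hypothesis BL : is_BL_algebra mul imp.
Local Open Scope order_scope.
Hypothesis dense_top : forall x : L, x < \top -> exists2 y, x < y & y < \top.

Lemma BL_mul_left_cont r t : r < t -> exists2 x, x < \top & r < mul x t.
Proof.
rewrite ltNge -(BL_imp_top BL) -ltx1 => /dense_top[x tr_x x1].
exists x => //; rewrite ltNge; apply/negP => /(BL_residuation BL).
by rewrite leNgt tr_x.
Qed.

Lemma BL_mul_self_cont r : r < \top -> exists2 s, s < \top & r < mul s s.
Proof.
move=> /dense_top[t rt t1]; have [x x1 rxt] := BL_mul_left_cont rt.
(* The maximum stays below [\top] and dominates both factors of [mul x t]. *)
exists (Order.max x t); first by rewrite gt_max x1 t1.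
by apply: (lt_le_trans rxt); apply: (BL_le_mul BL); rewrite le_max lexx ?orbT.
Qed.

Lemma star_open_ball a r : star_open mul imp (star_ball mul imp a r).
Proof.
(* Left continuity at [t = biimp a b] provides the radius [s] of a ball around [b]. *)
move=> b /BL_mul_left_cont[s s1 rs]; exists s; first exact: lt1_strongly_lt1.
move=> c /ltW sbc; apply: lt_le_trans (biimp_trans BL a b c).
by rewrite (BL_mulC BL); apply: (lt_le_trans rs); exact: (BL_le_mul BL).
Qed.

Lemma star_space_hausdorff : hausdorff_space (star_space mul imp).
Proof.
rewrite open_hausdorff => a b ab.
have ab1 : biimp mul imp a b < \top.
  by rewrite ltx1; apply: contra_neq ab; exact: (biimp_top BL).
have [s s1 abs] := BL_mul_self_cont ab1.
exists (star_ball mul imp a s, star_ball mul imp b s) => /=.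
  by split; rewrite inE /star_ball /= (biimpxx BL).
split; [exact: star_open_ball|exact: star_open_ball|].
(* A common point [c] would give [s * s <= (a <-> c) * (c <-> b) <= a <-> b]. *)
apply/eqP; rewrite -subset0 => c [/ltW sac /ltW].
rewrite (biimpC BL) => scb.
have := le_trans (BL_le_mul BL sac scb) (biimp_trans BL a c b).
by rewrite leNgt abs.
Qed.

End DenseChain.

Lemma unit_itv_dense_top (R : realType) (x : unit_itv R) :
  (x < \top)%O -> exists2 y : unit_itv R, (x < y)%O & (y < \top)%O.
Proof.
move=> x1; have {}x1 : (x%:num < 1 :> R)%R by [].
(* The witness is the midpoint of [x] and 1. *)
have [xm m1] := midf_lt x1.
have m0 : (0 <= (x%:num + 1) / 2 :> R)%R by rewrite (le_trans _ (ltW xm)).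
by exists (Itv01 m0 (ltW m1)).
Qed.

Theorem theorem4p2 (R : realType)
    (mul imp : unit_itv R -> unit_itv R -> unit_itv R)
    (BL : is_BL_algebra mul imp) :
  hausdorff_space (star_space mul imp).
Proof. exact/star_space_hausdorff/unit_itv_dense_top. Qed.
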